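(* Let $r>0$, and let $z_1,\ldots,z_N$ be point vortices with vorticities $\Gamma_1,\ldots,\Gamma_N\in\mathbb{R}\setminus\{0\}$ on the cylinder $\mathbb{C}/2\pi r\mathbb{Z}$. Suppose $\sum_{k=1}^N \Gamma_k\neq 0$. Then every relative equilibrium is an equilibrium. Moreover, if all the $\Gamma_k$ have the same sign, then in every equilibrium all the vortices are aligned on a single horizontal circle, and for each cyclic ordering of the $N$ labelled vortices around the horizontal circle there exists an equilibrium with that cyclic ordering, unique up to translation by $\mathbb{C}/2\pi r\mathbb{Z}$.
   Context: The cylinder of radius $r>0$ is $\mathbb{C}/2\pi r\mathbb{Z}$, with coordinate $z=x+iy$, where $x$ is read modulo $2\pi r$. A horizontal circle is a set $\{y=\text{constant}\}$. The phase space is the set of $N$-tuples $(z_1,\ldots,z_N)$ of pairwise distinct points of the cylinder. The motion of the point vortices is governed by $$\frac{dz_k}{dt}=\frac{i}{4\pi r}\sum_{l\neq k}\Gamma_l\,\cot\frac{\overline{z_k}-\overline{z_l}}{2r},\qquad k=1,\ldots,N.$$ The group $\mathbb{C}/2\pi r\mathbb{Z}$ acts diagonally on the phase space by translations, $(z_1,\ldots,z_N)\mapsto(z_1+g,\ldots,z_N+g)$. A relative equilibrium is a motion (solution) lying entirely in a single orbit of this group action. An equilibrium is a solution constant in time (equivalently, a configuration at which all the right-hand sides vanish). If all vortices lie on one horizontal circle, their cyclic ordering is the cyclic order in which the labels $1,\ldots,N$ occur as one goes around the circle in the direction of increasing $x$. *)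

(* Defs.v *)
(* MathComp + MathComp-Analysis, over an arbitrary [R : realType]; complex
   numbers are [R[i]] (mathcomp real-closed). *)
From HB Require Import structures.
From mathcomp Require Export all_boot all_order all_algebra all_fingroup.
From mathcomp Require Export all_classical all_reals all_analysis.
From mathcomp Require Export complex.
Import Order.TTheory GRing.Theory Num.Theory numFieldNormedType.Exports.

Set Implicit Arguments.
Unset Strict Implicit.
Unset Printing Implicit Defensive.

Local Open Scope classical_set_scope.
Local Open Scope complex_scope.
Local Open Scope ring_scope.

Section ComplexFunctions.
Variable R : realType.

Definition cexp (z : R[i]) : R[i] :=
  (expR (complex.Re z) * cos (complex.Im z)) +i*
  (expR (complex.Re z) * sin (complex.Im z)).

Definition ccos (z : R[i]) : R[i] := (cexp ('i%C * z) + cexp (- ('i%C * z))) / 2.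

Definition csin (z : R[i]) : R[i] :=
  (cexp ('i%C * z) - cexp (- ('i%C * z))) / (2 * 'i%C).

Definition ccot (z : R[i]) : R[i] := ccos z / csin z.

End ComplexFunctions.

Section PointVortices.
Variables (R : realType) (r : R) (N : nat).

(* Points of the cylinder C / 2 pi r Z are handled through representatives in
   C; [cyl_eq z w] says that z and w represent the same point. *)
Definition cyl_eq (z w : R[i]) : Prop :=
  exists m : int, z - w = (2 * pi * r * m%:~R)%:C.

Definition config := 'I_N -> R[i].

Definition same_config (z w : config) : Prop := forall k, cyl_eq (z k) (w k).

Definition in_phase_space (z : config) : Prop :=
  forall k l : 'I_N, k != l -> ~ cyl_eq (z k) (z l).

Definition translate (g : R[i]) (z : config) : config := fun k => z k + g.

(* [translate_equiv z w]: w lies in the orbit of z under the diagonal action of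
   the cylinder group. *)
Definition translate_equiv (z w : config) : Prop :=
  exists g : R[i], same_config w (translate g z).

(* The summands depend only on the points of the cylinder, since cot has
   period pi. *)
Definition velocity (Gamma : 'I_N -> R) (z : config) (k : 'I_N) : R[i] :=
  'i%C / (4 * pi * r)%:C *
  \sum_(l < N | l != k)
     (Gamma l)%:C * ccot ((conjc (z k) - conjc (z l)) / (2 * r)%:C).

(* The values of a curve outside the time set J are irrelevant.
   The components w^~ k are differentiable lifts to C of the vortex
   trajectories; every differentiable curve in the cylinder defined on an
   interval has such a lift. The derivative of a C-valued function of a real
   variable is taken componentwise. *)
Definition is_motion (Gamma : 'I_N -> R) (J : set R) (w : R -> config) : Prop :=
  forall t : R, J t ->
    in_phase_space (w t) /\
    forall k : 'I_N,
      is_derive t (1 : R) (fun s : R => complex.Re (w s k))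
        (complex.Re (velocity Gamma (w t) k)) /\
      is_derive t (1 : R) (fun s : R => complex.Im (w s k))
        (complex.Im (velocity Gamma (w t) k)).

Definition is_relative_equilibrium (Gamma : 'I_N -> R) (J : set R)
    (w : R -> config) : Prop :=
  is_motion Gamma J w /\
  exists z0 : config, forall t : R, J t -> translate_equiv z0 (w t).

Definition is_equilibrium (Gamma : 'I_N -> R) (z : config) : Prop :=
  in_phase_space z /\ forall k : 'I_N, velocity Gamma z k = 0.

Definition aligned (z : config) : Prop :=
  exists y : R, forall k : 'I_N, complex.Im (z k) = y.

(* A cyclic ordering is given by a listing s 0, s 1, ..., s (N - 1) of the
   labels, considered up to rotation. The listing describes z when the vortices
   lie on one horizontal circle and, for suitable lifts x i of the abscissa of
   vortex s i, x 0 < x 1 < ... < x (N - 1) < x 0 + 2 pi r. This does not change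
   when s is rotated. *)
Definition has_cyclic_order (s : 'S_N) (z : config) : Prop :=
  exists (x : 'I_N -> R) (y : R),
    (forall i : 'I_N, cyl_eq (z (s i)) (x i +i* y)) /\
    (forall i j : 'I_N, (i < j)%N -> x i < x j < x i + 2 * pi * r).

End PointVortices.

(* Main.v *)
Require Import Defs.
From mathcomp Require Import ring lra.
Import Order.TTheory GRing.Theory Num.Theory numFieldNormedType.Exports.

(** Relative equilibria. Along a motion inside one group orbit the differences
    z_k - z_l are constant modulo the period lattice; being continuous they are
    constant, so that all the velocities are one and the same number V. Since
    cot is odd, the sum of the Gamma_k V_k over all the vortices vanishes
    identically (pairwise cancellation, [sum_Gamma_velocity]). Hence
    V times the total vorticity is 0, V = 0, and the motion is constant.

    Alignment. The imaginary part of cot has the sign opposite to that of the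
    imaginary part of its argument ([Im_ccot_gt0]). At a highest vortex all the
    interaction terms therefore push in the same direction when the vorticities
    are positive, and they can cancel only if no vortex lies strictly below
    ([equilibrium_aligned]).

    Counting on a circle. Dividing abscissas by 2 r, an aligned equilibrium
    with a given ordering is a point x_0 < ... < x_(N-1) < x_0 + pi with
    sum_(l != k) m_l cot (x_k - x_l) = 0 for all k, where the weights m are the
    vorticities listed along the circle.
    - Uniqueness ([cot_balanced_unique]) is a maximum principle: compare two
      solutions x and y at the index k where y_k - x_k is largest. Each
      difference y_k - y_l is at least x_k - x_l, and cot is strictly decreasing
      between its poles, so that the two balance equations for k force
      y_l - x_l = y_k - x_k for all l.
    - Existence ([cot_balanced_exists]): the equations say that x is a critical
      point of the sum of the m_k m_l log (sin^2 (x_k - x_l)). This function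
      tends to minus infinity at the boundary of the cone of ordered
      configurations, so that it has a maximum among those with x_0 = 0. The
      equations for k != 0 are the vanishing of the partial derivatives there;
      the remaining one follows since the weighted sum of all the equations is
      identically zero.

    Negative vorticities reduce to positive ones, because the velocities are
    linear in Gamma. *)

Set Implicit Arguments.
Unset Strict Implicit.
Unset Printing Implicit Defensive.

Local Open Scope classical_set_scope.
Local Open Scope ring_scope.

(** * The complex cotangent *)

Section Cotangent.
Local Open Scope complex_scope.
Variable R : realType.
Implicit Types (a b : R) (z : R[i]).

Lemma ccosE a b : ccos (a +i* b) =
  ((expR (- b) + expR b) * cos a / 2) +i* ((expR (- b) - expR b) * sin a / 2).
Proof.
have two : (2 : R[i]) = (2 : R)%:C by rewrite rmorph_nat.
rewrite /ccos /cexp two -fmorphV; simpc; rewrite /= !(cosN, sinN, opprK).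
by congr (_ +i* _); field.
Qed.

Lemma csinE a b : csin (a +i* b) =
  ((expR (- b) + expR b) * sin a / 2) +i* ((expR b - expR (- b)) * cos a / 2).
Proof.
rewrite /csin.
have -> : (2 * 'i%C)^-1 = (0 +i* - (2^-1)) :> R[i].
  apply: (mulfI (_ : 2 * 'i%C != 0 :> R[i])).
    by rewrite mulf_neq0 ?pnatr_eq0// eq_complex /= oner_eq0 andbF.
  rewrite divff; last first.
    by rewrite mulf_neq0 ?pnatr_eq0// eq_complex /= oner_eq0 andbF.
  have -> : (2 : R[i]) = (2 : R)%:C by rewrite rmorph_nat.
  by simpc; congr (_ +i* _); field.
rewrite /cexp; simpc; rewrite /= !(cosN, sinN, opprK).
by congr (_ +i* _); field.
Qed.

(** The squared modulus of 2 sin (a + i b); it vanishes exactly at the poles. *)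
Definition cot_den a b : R :=
  ((expR (- b) - expR b) * cos a) ^+ 2 + ((expR (- b) + expR b) * sin a) ^+ 2.

(** Multiply numerator and denominator by the conjugate of sin (a + i b). At a
    pole both sides are 0, since the inverse of 0 is 0. *)
Lemma ccotE a b : ccot (a +i* b) =
  (4 * cos a * sin a / cot_den a b) +i*
  ((expR (- b) ^+ 2 - expR b ^+ 2) / cot_den a b).
Proof.
rewrite /ccot ccosE csinE /cot_den.
have pq : expR (- b) * expR b = 1 by rewrite -expRD addNr expR0.
have cs := cos2Dsin2 a.
move: (expR (- b)) (expR b) (cos a) (sin a) pq cs => p q c s pq cs.
set D := ((p - q) * c) ^+ 2 + ((p + q) * s) ^+ 2.
have invE x y :
    (x +i* y)^-1 = (x / (x ^+ 2 + y ^+ 2)) -i* (y / (x ^+ 2 + y ^+ 2)) :> R[i].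
  by [].
rewrite invE; set n2 := (_ / 2) ^+ 2 + _.
have -> : n2 = D / 4 by rewrite /n2 /D; field.
rewrite invfM invrK; simpc.
have E1 : 4 * c * s =
    (p + q) * c * ((p + q) * s) - (p - q) * s * ((p - q) * c).
  by transitivity (4 * c * s * (p * q)); [rewrite pq mulr1 | ring].
have E2 : p ^+ 2 - q ^+ 2 =
   (p - q) * s * ((p + q) * s) + (p + q) * c * ((p - q) * c).
  transitivity ((p ^+ 2 - q ^+ 2) * (c ^+ 2 + s ^+ 2)); last by ring.
  by rewrite cs mulr1.
have [->|D0] := eqVneq D 0;
  first by rewrite invr0 !(mulr0, mul0r, oppr0, addr0).
by rewrite E1 E2; congr (_ +i* _); field.
Qed.

Lemma sin_pi_int (m : int) : sin (pi * m%:~R) = 0 :> R.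
Proof.
have H n : sin (pi * n%:R) = 0 :> R.
  by rewrite mulr_natr -[_ *+ _]add0r (alternatingn (@sinDpi R)) sin0 mulr0.
by case: m => n; [exact: H | rewrite NegzE mulrNz mulrN sinN H oppr0].
Qed.

Lemma ccot_periodic z (m : int) : ccot (z + (pi * m%:~R)%:C) = ccot z.
Proof.
case: z => a b; simpc; rewrite !ccotE /cot_den.
have s0 := sin_pi_int m; have := cos2Dsin2 (pi * m%:~R : R).
rewrite s0 expr0n addr0 => c1.
rewrite cosD sinD s0 !mulr0 subr0 addr0.
set e := cos (pi * _) in c1 *.
set D' := _ + _; set D := ((expR (- b) - expR b) * cos a) ^+ 2 + _.
have -> : D' = D.
  rewrite -[RHS]mulr1 -[X in _ = _ * X]c1 /D' /D; ring.
have -> // : 4 * (cos a * e) * (sin a * e) = 4 * cos a * sin a.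
by rewrite -[RHS]mulr1 -[X in _ = _ * X]c1; ring.
Qed.

Lemma ccotN z : ccot (- z) = - ccot z.
Proof.
case: z => a b.
have oppE x y : - (x +i* y) = - x +i* - y :> R[i] by [].
rewrite oppE !ccotE oppE.
have -> : cot_den (- a) (- b) = cot_den a b.
  by rewrite /cot_den opprK cosN sinN; ring.
by rewrite opprK cosN sinN; congr (_ +i* _); ring.
Qed.

Lemma Im_ccot_gt0 z : complex.Im z < 0 -> 0 < complex.Im (ccot z).
Proof.
case: z => a b; rewrite ccotE /= => b0.
have qp : expR b < expR (- b) by rewrite ltr_expR; lra.
have q0 := expR_gt0 b.
apply: divr_gt0.
  by rewrite subr_gt0 ltr_pXn2r ?nnegrE ?ltW// (lt_trans q0).
have pq_neq0 : expR (- b) - expR b != 0 by rewrite subr_eq0 gt_eqF.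
have pq0 : expR (- b) + expR b != 0 by rewrite gt_eqF// addr_gt0// expR_gt0.
rewrite /cot_den lt0r addr_ge0 ?sqr_ge0// andbT paddr_eq0 ?sqr_ge0//.
rewrite !sqrf_eq0 !mulf_eq0 (negPf pq_neq0) (negPf pq0) /=.
apply/negP => /andP[/eqP c0 /eqP s0]; have := cos2Dsin2 a.
by rewrite c0 s0 expr0n addr0 => /esym/eqP; rewrite oner_eq0.
Qed.

Definition rcot a := cos a / sin a.

Lemma ccot_real a : ccot a%:C = (rcot a)%:C.
Proof.
rewrite ccotE /cot_den oppr0 expR0 subrr !mul0r expr0n add0r; congr (_ +i* _);
  last by rewrite subrr mul0r.
rewrite /rcot; have [->|s0] := eqVneq (sin a) 0; last by field.
by rewrite mulr0 invr0 !mulr0 mul0r.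
Qed.

Lemma rcotN a : rcot (- a) = - rcot a.
Proof. by rewrite /rcot cosN sinN invrN mulrN. Qed.

Lemma rcotB a b : sin a != 0 -> sin b != 0 ->
  rcot a - rcot b = sin (b - a) / (sin a * sin b).
Proof. by move=> a0 b0; rewrite sinB /rcot; field; rewrite a0 b0. Qed.

Lemma Im_ccot_ge0 z : complex.Im z <= 0 -> 0 <= complex.Im (ccot z).
Proof.
rewrite le_eqVlt => /orP[/eqP z0|/Im_ccot_gt0/ltW//].
have -> : z = (complex.Re z)%:C by case: z z0 => a b /= ->.
by rewrite ccot_real.
Qed.

End Cotangent.

(** * Points and velocities on the cylinder *)

Section Lattice.
Local Open Scope complex_scope.
Variables (R : realType) (r : R).
Implicit Types z w : R[i].

Lemma cyl_eq_sym z w : cyl_eq r z w -> cyl_eq r w z.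
Proof.
by case=> m H; exists (- m); rewrite -opprB H mulrNz mulrN rmorphN.
Qed.

Lemma cyl_eqD z1 w1 z2 w2 :
  cyl_eq r z1 w1 -> cyl_eq r z2 w2 -> cyl_eq r (z1 + z2) (w1 + w2).
Proof.
move=> [m H] [n K]; exists (m + n).
rewrite intrD [_ * (_ + _)]mulrDr rmorphD /= -H -K.
by rewrite addrACA opprD.
Qed.

Lemma cyl_eqN z w : cyl_eq r z w -> cyl_eq r (- z) (- w).
Proof. by move=> /cyl_eq_sym[m H]; exists m; rewrite -H opprK addrC. Qed.

Lemma cyl_eqB z1 w1 z2 w2 :
  cyl_eq r z1 w1 -> cyl_eq r z2 w2 -> cyl_eq r (z1 - z2) (w1 - w2).
Proof. by move=> H /cyl_eqN; exact: cyl_eqD. Qed.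

Lemma cyl_eq_trans z w u : cyl_eq r z w -> cyl_eq r w u -> cyl_eq r z u.
Proof.
move=> [m H] [n K]; exists (m + n).
by rewrite intrD [_ * (_ + _)]mulrDr rmorphD /= -H -K subrKA.
Qed.

Lemma cyl_eq_Im z w : cyl_eq r z w -> complex.Im z = complex.Im w.
Proof. by case: z w => a b [c d] [m [_ /eqP]]; rewrite subr_eq0 => /eqP. Qed.

Lemma ccot_cyl_eq z w : 0 < r -> cyl_eq r z w ->
  ccot (conjc z / (2 * r)%:C) = ccot (conjc w / (2 * r)%:C).
Proof.
move=> r0 [m /eqP]; rewrite subr_eq => /eqP ->.
rewrite -[RHS](ccot_periodic _ m); congr ccot.
have -> x : conjc (x%:C + w) = x%:C + conjc w.
  by rewrite rmorphD; congr (_ + _); exact: conjc_real.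
rewrite addrC mulrDl; congr (_ + _).
by rewrite -fmorphV -rmorphM; congr (_ %:C); field; rewrite gt_eqF.
Qed.

End Lattice.

(** Exchanging the two sums changes the sign of the total. *)
Lemma sum_antisym (A : numDomainType) (I : finType) (f : I -> I -> A) :
  (forall k l, f k l = - f l k) -> \sum_k \sum_(l | l != k) f k l = 0.
Proof.
move=> fN; set S := LHS; suff SN : S = - S by apply/eqP; rewrite -eqNr -SN.
rewrite {1}/S (exchange_big_dep predT)//= /S -sumrN; apply: eq_bigr => k _.
by rewrite -sumrN; apply: eq_big => [l|l _]; [rewrite eq_sym | exact: fN].
Qed.

Section Velocity.
Local Open Scope complex_scope.
Variables (R : realType) (r : R) (N : nat).
Hypothesis r0 : 0 < r.
Implicit Types (Gamma : 'I_N -> R) (z w : config R N).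

(** The velocity of vortex k without its factor i / (4 pi r), and written with
    the conjugate of a difference: this form visibly depends only on the
    relative positions modulo the periods. *)
Definition cot_sum Gamma z k : R[i] :=
  \sum_(l < N | l != k) (Gamma l)%:C * ccot (conjc (z k - z l) / (2 * r)%:C).

Lemma velocityE Gamma z k :
  velocity r Gamma z k = 'i%C / (4 * pi * r)%:C * cot_sum Gamma z k.
Proof.
by congr (_ * _); apply: eq_bigr => l _; rewrite rmorphB.
Qed.

Lemma velocity_eq0 Gamma z k :
  (velocity r Gamma z k == 0) = (cot_sum Gamma z k == 0).
Proof.
rewrite velocityE mulf_eq0 mulf_eq0 invr_eq0.
rewrite (_ : ('i%C == 0 :> R[i]) = false); last first.
  by rewrite eq_complex /= oner_eq0 andbF.
by rewrite (fmorph_eq0 (real_complex R)) gt_eqF// !mulr_gt0// pi_gt0.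
Qed.

Lemma cot_sum_congr Gamma z w :
  (forall k l, cyl_eq r (z k - z l) (w k - w l)) ->
  cot_sum Gamma z =1 cot_sum Gamma w.
Proof.
by move=> H k; apply: eq_bigr => l _; rewrite (ccot_cyl_eq r0 (H k l)).
Qed.

Lemma velocity_congr Gamma z w :
  (forall k l, cyl_eq r (z k - z l) (w k - w l)) ->
  velocity r Gamma z =1 velocity r Gamma w.
Proof. by move=> H k; rewrite !velocityE (cot_sum_congr _ H). Qed.

Lemma velocity_oppr Gamma z k :
  velocity r (fun l => - Gamma l) z k = - velocity r Gamma z k.
Proof.
rewrite /velocity -mulrN -sumrN; congr (_ * _); apply: eq_bigr => l _.
by rewrite rmorphN mulNr.
Qed.

Lemma sum_Gamma_cot_sum Gamma z : \sum_k (Gamma k)%:C * cot_sum Gamma z k = 0.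
Proof.
under eq_bigr do rewrite mulr_sumr.
apply: sum_antisym => k l.
by rewrite -opprB rmorphN mulNr ccotN !mulrN mulrCA.
Qed.

(** The mutual interactions cancel pairwise: the cylinder form of the
    conservation of linear impulse. *)
Lemma sum_Gamma_velocity Gamma z :
  \sum_k (Gamma k)%:C * velocity r Gamma z k = 0.
Proof.
under eq_bigr do rewrite velocityE mulrCA.
by rewrite -mulr_sumr sum_Gamma_cot_sum mulr0.
Qed.

End Velocity.

(** * Relative equilibria *)

Section RelativeEquilibria.
Variable R : realType.

(** A function that is continuous at t and takes values in a coset of a lattice
    is constant near t. *)
Lemma is_derive_lattice_valued (f : R -> R) (t a c : R) (J : set R) :
  0 < c -> nbhs t J ->
  (forall s, J s -> exists m : int, f s - f t = c * m%:~R) ->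
  is_derive t (1 : R) f a -> a = 0.
Proof.
move=> c0 Jt fJ dfa.
have cf : {for t, continuous f}.
  by apply/differentiable_continuous/derivable1_diffP; case: dfa.
have fE : \forall s \near t, f s = cst (f t) s.
  move/cvgrPdist_lt : cf => /(_ c c0) cf.
  near=> s => /=.
  have /fJ [m fm] : J s by near: s.
  have : `|f t - f s| < c by near: s.
  rewrite distrC fm normrM gtr0_norm// gtr_pMr// -intr_norm ltrz1.
  rewrite ltNge -gtz0_ge1 normr_gt0 negbK => /eqP m0.
  by apply/eqP; rewrite -subr_eq0; move: fm; rewrite m0 mulr0 => ->.
have dc := near_eq_is_derive fE dfa.
by rewrite -(@derive_val _ _ _ _ _ _ _ dc) derive_cst.
Unshelve. all: by end_near. Qed.

Lemma is_derive0_interval_cst (f : R -> R) (J : set R) : is_interval J ->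
  (forall t, J t -> is_derive t (1 : R) f 0) ->
  forall s t, J s -> J t -> f s = f t.
Proof.
move=> iJ df s t; wlog st : s t / s <= t.
  move=> H Js Jt; case/orP: (le_total s t) => [st|ts].
  - by apply: H.
  - by apply/esym/H.
move=> Js Jt.
have dst x : x \in `[s, t] -> is_derive x (1 : R) f 0.
  by rewrite in_itv /= => xst; apply: df; apply: (iJ s t).
have doo x : x \in `]s, t[ -> is_derive x (1 : R) f (cst 0 x).
  by move=> xst; apply: dst; apply: subset_itv_oo_cc xst.
have cf : {within `[s, t], continuous f}.
  by apply: derivable_within_continuous => x xst; have [] := dst x xst.
have [x _] := MVT_segment st doo cf.
by rewrite mul0r => /eqP; rewrite subr_eq0 => /eqP.
Qed.

Theorem relative_equilibrium_is_equilibrium (r : R) (N : nat)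
    (Gamma : 'I_N -> R) (J : set R) (w : R -> config R N) :
  0 < r -> \sum_(k < N) Gamma k != 0 ->
  open J -> is_interval J -> J !=set0 ->
  is_relative_equilibrium r Gamma J w ->
  exists z0 : config R N,
    is_equilibrium r Gamma z0 /\ forall t : R, J t -> same_config r (w t) z0.
Proof.
move=> r0 sG oJ iJ [t0 Jt0] [mw [z0 wz0]].
have diffw s t k l : J s -> J t ->
    cyl_eq r (w s k - w s l) (w t k - w t l).
  have dz u : J u -> cyl_eq r (w u k - w u l) (z0 k - z0 l).
    move=> /wz0[g wg]; have := cyl_eqB (wg k) (wg l).
    by rewrite /translate opprD addrACA subrr addr0.
  by move=> Js Jt; apply: cyl_eq_trans (dz _ Js) (cyl_eq_sym (dz _ Jt)).
pose V k := velocity r Gamma (w t0) k.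
have VE t k : J t -> velocity r Gamma (w t) k = V k.
  by move=> Jt; apply: velocity_congr => // i j; exact: diffw.
have nJ : nbhs t0 J by exact: open_nbhs_nbhs.
have c0 : 0 < 2 * pi * r by rewrite !mulr_gt0 ?pi_gt0.
have Vcst k l : V k = V l.
  have [_ dw] := mw t0 Jt0.
  have [[dRk dIk] [dRl dIl]] := (dw k, dw l).
  apply/eqP; rewrite eq_complex.
  apply/andP; split; rewrite -subr_eq0; apply/eqP.
  - apply: (is_derive_lattice_valued c0 nJ _ (is_deriveB dRk dRl)) => s Js.
    have [m /(congr1 (@complex.Re R)) H] := diffw _ _ k l Js Jt0.
    by exists m; move: H => /=; rewrite !raddfB.
  - apply: (is_derive_lattice_valued c0 nJ _ (is_deriveB dIk dIl)) => s Js.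
    exists 0; rewrite mulr0; apply/eqP; rewrite subr_eq0; apply/eqP.
    have /cyl_eq_Im := diffw _ _ k l Js Jt0.
    by rewrite !raddfB.
have V0 k : V k = 0.
  have := sum_Gamma_velocity r Gamma (w t0).
  under eq_bigr do rewrite -/(V _) (Vcst _ k).
  rewrite -mulr_suml -rmorph_sum => /eqP; rewrite mulf_eq0 fmorph_eq0.
  by rewrite (negPf sG) => /eqP.
exists (w t0); split; first by split=> //; have [] := mw t0 Jt0.
move=> t Jt k; exists 0; rewrite mulr0 rmorph0.
have dR u : J u -> is_derive u (1 : R) (fun s => complex.Re (w s k)) 0.
  by move=> Ju; have [_ /(_ k)[+ _]] := mw u Ju; rewrite VE// V0.
have dI u : J u -> is_derive u (1 : R) (fun s => complex.Im (w s k)) 0.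
  by move=> Ju; have [_ /(_ k)[_ +]] := mw u Ju; rewrite VE// V0.
apply/eqP; rewrite subr_eq0 eq_complex.
rewrite (is_derive0_interval_cst iJ dR Jt Jt0).
by rewrite (is_derive0_interval_cst iJ dI Jt Jt0) !eqxx.
Qed.

End RelativeEquilibria.

(** * Alignment *)

Section Alignment.
Variable R : realType.
Local Open Scope complex_scope.

(** At a highest vortex k, all the terms of the imaginary part of the
    interaction sum are nonnegative, and those of the vortices strictly below
    are positive. *)
Lemma equilibrium_aligned (r : R) (N : nat) (Gamma : 'I_N -> R)
    (z : config R N) :
  0 < r -> (forall k, 0 < Gamma k) -> is_equilibrium r Gamma z -> aligned z.
Proof.
move=> r0 G0 [_ vz]; case: (pickP 'I_N) => [k0 _|none]; last first.
  by exists 0 => k; have := none k.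
have [k _ kmax] := arg_maxP (fun k => complex.Im (z k)) (isT : xpredT k0).
exists (complex.Im (z k)) => l; apply/eqP; apply/negPn/negP => lk.
have /eqP := vz k; rewrite velocity_eq0// => /eqP/(congr1 (@complex.Im R)).
have ImM x u : complex.Im (x%:C * u) = x * complex.Im u.
  by case: u => a b /=; rewrite mul0r addr0.
(* The conjugation in the equations of motion turns the vortices below k into
   arguments of cot with negative imaginary part. *)
have ImE j : complex.Im ((z k - z j)^*%C / (2 * r)%:C) =
    (complex.Im (z j) - complex.Im (z k)) / (2 * r).
  rewrite mulrC -fmorphV ImM mulrC; congr (_ / _).
  by case: (z k) (z j) => a b [c d] /=; ring.
have r2 : 0 < (2 * r)^-1 by rewrite invr_gt0 mulr_gt0.
have -> : complex.Im (cot_sum r Gamma z k) = \sum_(j < N | j != k)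
    complex.Im ((Gamma j)%:C * ccot ((z k - z j)^*%C / (2 * r)%:C)).
  by rewrite /cot_sum raddf_sum.
move=> /eqP; rewrite psumr_eq0; last first.
  move=> j _; rewrite ImM mulr_ge0 ?(ltW (G0 j))// Im_ccot_ge0// ImE.
  by rewrite pmulr_lle0// subr_le0; exact: kmax.
move=> /allP /(_ l (mem_index_enum _)) /implyP.
have lk' : l != k by apply: contraNneq lk => ->.
move=> /(_ lk'); rewrite ImM gt_eqF// mulr_gt0// Im_ccot_gt0// ImE.
by rewrite pmulr_llt0// subr_lt0 lt_neqAle lk; exact: kmax.
Qed.

End Alignment.

(** * Ordered real solutions of the balance equations: uniqueness *)

Section CotangentBalance.
Variable R : realType.

(** The period is pi, not 2 pi r: abscissas are divided by 2 r throughout. *)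
Definition ordered_cone (N : nat) (x : 'I_N -> R) :=
  forall i j : 'I_N, (i < j)%N -> x i < x j < x i + pi.

Definition cot_balanced (N : nat) (m x : 'I_N -> R) :=
  forall k, \sum_(l < N | l != k) m l * rcot (x k - x l) = 0.

Lemma ordered_cone_sin_gt0 N (x : 'I_N -> R) (i j : 'I_N) :
  ordered_cone x -> (i < j)%N -> 0 < sin (x j - x i).
Proof. by move=> cx /cx xij; apply: sin_gt0_pi; lra. Qed.

Lemma ordered_cone_sin_neq0 N (x : 'I_N -> R) (i j : 'I_N) :
  ordered_cone x -> j != i -> sin (x i - x j) != 0.
Proof.
move=> cx; rewrite neq_ltn => /orP[ji|ij].
  by rewrite gt_eqF// ordered_cone_sin_gt0.
by rewrite -opprB sinN oppr_eq0 gt_eqF// ordered_cone_sin_gt0.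
Qed.

(** The condition on the product says that the interval from u to v, of length
    less than pi, contains no pole of cot. *)
Lemma rcot_decreasing (u v : R) : 0 < sin u * sin v -> u < v < u + pi ->
  rcot v < rcot u.
Proof.
move=> suv uv; have := gt_eqF suv; rewrite mulf_eq0 => /negbT.
rewrite negb_or => /andP[u0 v0].
by rewrite -subr_gt0 rcotB// divr_gt0// sin_gt0_pi//; lra.
Qed.

(** Maximum principle, at an index where y - x is largest. *)
Lemma cot_balanced_unique N (m x y : 'I_N -> R) : (forall k, 0 < m k) ->
  ordered_cone x -> ordered_cone y -> cot_balanced m x -> cot_balanced m y ->
  exists d, forall k, y k = x k + d.
Proof.
move=> m0 cx cy bx byy; case: (pickP 'I_N) => [k0 _|none]; last first.
  by exists 0 => k; have := none k.
have [k _ kmax] := arg_maxP (fun k => y k - x k) (isT : xpredT k0).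
exists (y k - x k) => l; have [->|lk] := eqVneq l k; first lra.
have lt_cot j : j != k -> y j - x j < y k - x k ->
    rcot (y k - y j) < rcot (x k - x j).
  move=> jk yxj; apply: rcot_decreasing.
  - case: (ltngtP j k) => [jk'|kj|/val_inj/eqP]; last by rewrite (negPf jk).
      by rewrite mulr_gt0// ordered_cone_sin_gt0.
    rewrite -(opprB (x j)) -(opprB (y j)) !sinN mulrNN.
    by rewrite mulr_gt0// ordered_cone_sin_gt0.
  - case: (ltngtP j k) => [jk'|kj|/val_inj/eqP]; last by rewrite (negPf jk).
      by have := cx _ _ jk'; have := cy _ _ jk'; lra.
    by have := cx _ _ kj; have := cy _ _ kj; lra.
have le_cot j : j != k -> rcot (y k - y j) <= rcot (x k - x j).
  move=> jk; have := kmax j isT.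
  rewrite /= le_eqVlt => /orP[/eqP e|/lt_cot/ltW].
    by rewrite (_ : y k - y j = x k - x j)//; lra.
  exact.
have /eqP :
    \sum_(j < N | j != k) m j * (rcot (x k - x j) - rcot (y k - y j)) = 0.
  by under eq_bigr do rewrite mulrBr; rewrite sumrB bx byy subrr.
rewrite psumr_eq0; last first.
  by move=> j jk; rewrite mulr_ge0 ?(ltW (m0 j))// subr_ge0 le_cot.
move=> /allP /(_ l (mem_index_enum _)) /implyP /(_ lk).
have := kmax l isT; rewrite /= le_eqVlt => /orP[/eqP e _|]; first lra.
by move=> /(lt_cot _ lk) lc; rewrite gt_eqF// mulr_gt0// subr_gt0.
Qed.

End CotangentBalance.

(** * The logarithmic energy and its maximum *)

Section LogarithmicEnergy.
Variable R : realType.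

Lemma is_derive_bigsum (I : finType) (P : pred I) (f : I -> R -> R)
    (df : I -> R) (t : R) :
  (forall i, P i -> is_derive t (1 : R) (f i) (df i)) ->
  is_derive t (1 : R) (fun s => \sum_(i | P i) f i s) (\sum_(i | P i) df i).
Proof.
move=> dfi; rewrite (_ : (fun s => _) = \sum_(i | P i) f i); last first.
  by apply/funext => s; rewrite fct_sumE.
elim/big_ind2 : _ => // [|f1 d1 f2 d2 h1 h2]; first exact: is_derive_cst.
exact: is_deriveD.
Qed.

Section Energy.
Variables (N : nat) (m : 'I_N -> R).

(** The interaction Hamiltonian of the aligned vortices, up to a constant
    factor. The square makes the summand symmetric in i and j, so that the sum
    can range over ordered pairs. *)
Definition energy (x : 'I_N -> R) : R :=
  \sum_i \sum_(j | j != i) m i * m j * ln (sin (x i - x j) ^+ 2).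

Lemma is_derive_energy (x e : 'I_N -> R) (t : R) :
  (forall i j, j != i -> sin ((x i + t * e i) - (x j + t * e j)) != 0) ->
  is_derive t (1 : R) (fun s => energy (fun i => x i + s * e i))
    (\sum_i \sum_(j | j != i) m i * m j *
       ((e i - e j) * (2 * rcot ((x i + t * e i) - (x j + t * e j))))).
Proof.
move=> s0; apply: is_derive_bigsum => i _; apply: is_derive_bigsum => j ji.
pose u (s : R) := (x i + s * e i) - (x j + s * e j).
have du : is_derive t (1 : R) u (e i - e j).
  by apply: is_derive_eq; rewrite /GRing.scale /=; ring.
have dsin := is_derive1_comp (is_derive_sin (u t)) du.
have dsin2 := is_deriveX 2 dsin.
have sut : sin (u t) != 0 by exact: s0.
have sut2 : 0 < ((@sin R \o u) ^+ 2) t by rewrite exprfctE /= exprn_even_gt0.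
have dln := is_derive1_comp (is_derive1_ln sut2) dsin2.
have dz := is_deriveZ (m i * m j) dln.
apply: is_derive_eq dz _; rewrite /GRing.scale /= /rcot -/(u t).
by rewrite exprfctE /= expr1; field.
Qed.

Hypothesis m0 : forall k, 0 < m k.

(** All the other terms are nonpositive, because sin^2 <= 1. *)
Lemma energy_le_term (x : 'I_N -> R) (i j : 'I_N) : j != i ->
  energy x <= m i * m j * ln (sin (x i - x j) ^+ 2).
Proof.
move=> ji.
have le0 k l : m k * m l * ln (sin (x k - x l) ^+ 2) <= 0.
  apply: mulr_ge0_le0; first by rewrite mulr_ge0// ltW.
  by apply: ln_le0; rewrite -real_normK ?num_real// expr_le1// sin_max.
rewrite /energy (bigD1 i)//= (bigD1 j)//= -addrA gerDl.
have h1 : \sum_(l | (l != i) && (l != j))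
    m i * m l * ln (sin (x i - x l) ^+ 2) <= 0.
  exact: sumr_le0.
have h2 : \sum_(k | k != i) \sum_(l | l != k)
    m k * m l * ln (sin (x k - x l) ^+ 2) <= 0.
  by apply: sumr_le0 => k _; exact: sumr_le0.
by have := lerD h1 h2; rewrite addr0.
Qed.

End Energy.

Lemma continuous_energy N (m : 'I_N -> R) (v : 'rV[R]_N) :
  (forall i j, j != i -> sin (v 0 i - v 0 j) != 0) ->
  {for v, continuous (fun u : 'rV[R]_N => energy m (u 0))}.
Proof.
move=> s0; have fv : Filter (nbhs v) by exact: nbhs_filter.
rewrite /prop_for /continuous_at /energy.
apply: cvg_big => [|i _]; first exact: add_continuous.
apply: cvg_big => [|j ji]; first exact: add_continuous.
apply: cvgM; first exact: cvg_cst.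
apply: (@continuous_comp _ _ _
  (fun u : 'rV[R]_N => sin (u 0 i - u 0 j) ^+ 2) (@ln R)).
  apply: (@continuous_comp _ _ _
    (fun u : 'rV[R]_N => sin (u 0 i - u 0 j)) (fun s => s ^+ 2)).
    apply: (@continuous_comp _ _ _
      (fun u : 'rV[R]_N => u 0 i - u 0 j) (@sin R)).
      by apply: cvgB; exact: coord_continuous.
    exact: continuous_sin.
  exact: exprn_continuous.
by apply: continuous_ln; rewrite exprn_even_gt0//=; exact: s0.
Qed.

End LogarithmicEnergy.

Section Maximum.
Variables (R : realType) (n : nat).

(** A compact exhaustion of the ordered configurations with x_0 = 0. Within the
    box, the lower bound on the sines alone enforces the strict ordering and
    the bound on the spread ([truncated_cone_ordered]); so only closed
    conditions occur. *)
Definition truncated_cone (delta : R) : set 'rV[R]_n.+1 :=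
  [set v | (forall i, v 0 i \in `[0, if i == 0 then 0 else pi]) /\
           (forall i j : 'I_n.+1, (i < j)%N -> delta <= sin (v 0 j - v 0 i))].

Lemma truncated_cone_compact delta : compact (truncated_cone delta).
Proof.
pose box : set 'rV[R]_n.+1 :=
  [set v | forall i, [set` `[0, if i == 0 then 0 else pi]] (v 0 i)].
have cbox : compact box.
  apply: (@rV_compact R n.+1
    (fun i => [set` `[0, if i == 0 then 0 else pi]])) => i.
  exact: segment_compact.
apply: (subclosed_compact _ cbox); last by move=> v [].
have -> : truncated_cone delta =
    (\bigcap_(i in setT) ((fun v : 'rV[R]_n.+1 => v 0 i) @^-1`
        [set` `[0, if i == 0 then 0 else pi]])) `&`
    (\bigcap_(p in [set p : 'I_n.+1 * 'I_n.+1 | (p.1 < p.2)%N])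
      ((fun v : 'rV[R]_n.+1 => sin (v 0 p.2 - v 0 p.1)) @^-1`
        [set s | delta <= s])).
  apply/seteqP; split=> v [h1 h2]; split.
  - by move=> i _; exact: h1.
  - by move=> p; exact: h2.
  - by move=> i; exact: h1.
  - by move=> i j ij; exact: (h2 (i, j)).
apply: closedI; apply: closed_bigI => i _; apply: preimage_closed.
- by move=> v _; exact: (@coord_continuous R 1 n.+1 0 i).
- exact: interval_closed.
- move=> v _; apply: (@continuous_comp _ _ _
    (fun u : 'rV[R]_n.+1 => u 0 i.2 - u 0 i.1) (@sin R)).
    by apply: cvgB; [exact: nbhs_filter | exact: coord_continuous ..].
  exact: continuous_sin.
- exact: closed_ge.
Qed.

Lemma truncated_cone_ordered delta v : 0 < delta ->
  truncated_cone delta v -> ordered_cone (v 0).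
Proof.
move=> d0 [box sv] i j /sv/(lt_le_trans d0) sij.
have vpi k : 0 <= v 0 k <= pi.
  have := box k; rewrite in_itv /=; case: ifP => // _ /andP[-> /= vk].
  by rewrite (le_trans vk)// pi_ge0.
have := (vpi i, vpi j) => -[vi vj].
apply/andP; split; rewrite ltNge; apply/negP => h; move: sij.
  apply/negP; rewrite -leNgt -opprB sinN oppr_le0 sin_ge0_pi//; lra.
have -> : v 0 j - v 0 i = pi by lra.
by rewrite sinpi ltxx.
Qed.

Lemma ordered_cone_nonempty :
  exists x : 'I_n.+1 -> R, x 0 = 0 /\ ordered_cone x.
Proof.
(* Equally spaced points; dividing by n.+1 keeps the spread below pi. *)
exists (fun i : 'I_n.+1 => pi * (i%:R / n.+1%:R)); split.
  by rewrite mul0r mulr0.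
move=> i j ij; rewrite ltr_pM2l ?pi_gt0//.
rewrite ltr_pM2r ?invr_gt0 ?ltr0n// ltr_nat ij.
rewrite -[X in _ < _ + X]mulr1 -mulrDr ltr_pM2l ?pi_gt0//=.
rewrite ltr_pdivrMr ?ltr0n// mulrDl divfK ?pnatr_eq0//.
by rewrite mul1r -natrD ltr_nat ltn_addl.
Qed.

Variable m : 'I_n.+1 -> R.
Hypothesis m0 : forall k, 0 < m k.

(** Two nearby vortices, or two vortices nearly a full turn apart, make a single
    term very negative, and no other term can compensate
    ([energy_le_term]). *)
Lemma energy_coercive (E : R) : exists2 delta : R, 0 < delta &
  forall (x : 'I_n.+1 -> R) (i j : 'I_n.+1), ordered_cone x -> (i < j)%N ->
    sin (x j - x i) < delta -> energy m x < E.
Proof.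
have /filter_ex[M HM] :
    \forall M \near +oo, forall i j, - E / (m i * m j * 2) < M.
  by apply: filter_forall => i; apply: filter_forall => j;
    exact: nbhs_pinfty_gt (num_real _).
exists (expR (- M)) => [|x i j cx ij sij]; first exact: expR_gt0.
have s0 := ordered_cone_sin_gt0 cx ij.
have ji : i != j by rewrite neq_ltn ij.
apply: le_lt_trans (energy_le_term m0 x ji) _.
have mm : 0 < m j * m i by rewrite mulr_gt0.
have lnM : ln (sin (x j - x i) ^+ 2) < - (M * 2).
  rewrite lnXn// -[X in _ < X]mulNr -[X in X < _]mulr_natr ltr_pM2r//.
  by rewrite -[X in _ < X]expRK ltr_ln// posrE expR_gt0.
have := HM j i; rewrite ltr_pdivrMr ?mulr_gt0// => h.
apply: lt_trans (_ : m j * m i * - (M * 2) < _); first by rewrite ltr_pM2l.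
lra.
Qed.

(** The maximum over a truncated cone chosen such that, outside of it, the
    energy is less than at some reference configuration. *)
Lemma energy_has_max : exists x : 'I_n.+1 -> R, [/\ x 0 = 0, ordered_cone x &
  forall y : 'I_n.+1 -> R, y 0 = 0 -> ordered_cone y ->
    energy m y <= energy m x].
Proof.
have [ref [ref0 cref]] := ordered_cone_nonempty.
have [delta d0 low] := energy_coercive (energy m ref).
have inK (y : 'I_n.+1 -> R) : y 0 = 0 -> ordered_cone y ->
    (forall i j : 'I_n.+1, (i < j)%N -> delta <= sin (y j - y i)) ->
    truncated_cone delta (\row_i y i).
  move=> y0 cy sy; split=> [i|i j ij]; last by rewrite !mxE sy.
  rewrite mxE in_itv /=; have [->|i0] := eqVneq i 0; first by rewrite y0 lexx.
  have /cy : ((0%R : 'I_n.+1) < i)%N by rewrite lt0n.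
  by rewrite y0; lra.
have energyE y : energy m ((\row_i y i) 0) = energy m y.
  by congr energy; apply/funext => i; rewrite mxE.
have refK : truncated_cone delta (\row_i ref i).
  apply: inK => // i j ij; rewrite leNgt; apply/negP => /(low _ _ _ cref ij).
  by rewrite ltxx.
have cE : {within truncated_cone delta,
    continuous (fun v : 'rV[R]_n.+1 => energy m (v 0))}.
  apply: continuous_in_subspaceT => v; rewrite inE => vK.
  have cv := truncated_cone_ordered d0 vK.
  by apply: continuous_energy => i j; exact: ordered_cone_sin_neq0.
have [v] := EVT_max_rV (ex_intro _ _ refK) (@truncated_cone_compact delta) cE.
rewrite inE => vK vmax; exists (v 0); split.
- by have [/(_ 0) + _] := vK; rewrite in_itv /= -eq_le => /eqP.
- exact: truncated_cone_ordered vK.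
move=> y y0 cy.
have [|/existsNP[i /existsNP[j /not_implyP[ij /negP]]]] :=
  pselect (forall i j : 'I_n.+1, (i < j)%N -> delta <= sin (y j - y i)).
  by move=> /(inK _ y0 cy) yK; rewrite -energyE; apply: vmax; rewrite inE.
rewrite -ltNge => /(low _ _ _ cy ij)/ltW/le_trans; apply.
by rewrite -energyE; apply: vmax; rewrite inE.
Qed.

End Maximum.

(** * Ordered real solutions of the balance equations: existence *)

Section Critical.
Variable R : realType.

Lemma near_affine_lt (a b p q : R) : a < b ->
  \forall t \near (0 : R), a + t * p < b + t * q.
Proof.
move=> ab; near do rewrite -subr_gt0.
have cf : (b + t * q - (a + t * p)) @[t --> (0 : R)] -->
    b + 0 * q - (a + 0 * p).
  by apply: cvgB; apply: cvgD; [exact: cvg_cst| apply: cvgMl; exact: cvg_id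
    | exact: cvg_cst | apply: cvgMl; exact: cvg_id].
by apply: (cvgr_gt _ cf); lra.
Unshelve. all: by end_near. Qed.

(** The ordered configurations form an open set, so that a maximum of the
    energy on it is a critical point. *)
Lemma near_ordered_cone N (x e : 'I_N -> R) : ordered_cone x ->
  \forall t \near (0 : R), ordered_cone (fun i => x i + t * e i).
Proof.
move=> cx.
have H : \forall t \near (0 : R), forall i j : 'I_N, (i < j)%N ->
    x i + t * e i < x j + t * e j < x i + pi + t * e i.
  have f0 := @nbhs_filter R 0.
  apply: (filter_forall f0) => i; apply: (filter_forall f0) => j.
  have [ij|] := boolP (i < j)%N; last by move=> _; exact: nearW.
  have /andP[h1 h2] := cx _ _ ij.
  near=> t => _; apply/andP; split; near: t; exact: near_affine_lt.
by apply: filterS H => t h i j /h; rewrite addrAC.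
Unshelve. all: by end_near. Qed.

(** The balance equations are the Euler equations of the energy at its maximum
    under the normalization x_0 = 0; only directions e with e_0 = 0 are
    admissible, and the equation for the index 0 is recovered from the
    others. *)
Lemma cot_balanced_exists N (m : 'I_N -> R) : (forall k, 0 < m k) ->
  exists x : 'I_N -> R, ordered_cone x /\ cot_balanced m x.
Proof.
case: N m => [|n] m m0; first by exists (fun=> 0); split; case.
have [x [x0 cx xmax]] := energy_has_max m0; exists x; split=> //.
pose c i j := m i * m j * (2 * rcot (x i - x j)).
have cN i j : c i j = - c j i.
  by rewrite /c -(opprB (x j)) rcotN; ring.
have stationary (e : 'I_n.+1 -> R) : e 0 = 0 ->
    \sum_i \sum_(j | j != i) (e i - e j) * c i j = 0.
  move=> e0; pose y (t : R) i := x i + t * e i.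
  have /nbhs_ballP[d /= d0 cd] := near_ordered_cone e cx.
  have cy t : t \in `](- d), d[ -> ordered_cone (y t).
    move=> td; apply: cd; rewrite /ball /= sub0r normrN ltr_norml.
    by move: td; rewrite in_itv.
  have dE t : t \in `](- d), d[ ->
      is_derive t (1 : R) (fun s => energy m (y s))
        (\sum_i \sum_(j | j != i) m i * m j *
          ((e i - e j) * (2 * rcot (y t i - y t j)))).
    move=> td; apply: is_derive_energy => i j ji.
    exact: ordered_cone_sin_neq0 (cy t td) ji.
  have y00 : y 0 = x by apply/funext => i; rewrite /y mul0r addr0.
  have d00 : 0 \in `](- d), d[ by rewrite in_itv /=; lra.
  have dmax : is_derive 0 (1 : R) (fun s => energy m (y s)) 0.
    apply: (@derive1_at_max _ _ (- d) d) => // [|t td|t td]; first lra.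
      by case: (dE t td).
    by rewrite y00; apply: xmax; [rewrite /y e0 mulr0 x0 addr0 | exact: cy].
  have := @derive_val _ _ _ _ _ _ _ (dE 0 d00).
  rewrite (@derive_val _ _ _ _ _ _ _ dmax) y00 => /esym H.
  rewrite -[RHS]H; apply: eq_bigr => i _; apply: eq_bigr => j _.
  by rewrite /c; ring.
have bal k : \sum_(l < n.+1 | l != k) c k l =
    2 * m k * \sum_(l < n.+1 | l != k) m l * rcot (x k - x l).
  by rewrite mulr_sumr; apply: eq_bigr => l _; rewrite /c; ring.
(* Since (e_i - e_j) = 2 e_i - (e_i + e_j), the two differ by a sum that is
   antisymmetric in i and j. *)
have half e : \sum_i \sum_(j | j != i) (e i - e j) * c i j =
    2 * \sum_i e i * \sum_(j | j != i) c i j.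
  have anti : \sum_i \sum_(j | j != i) (e i + e j) * c i j = 0.
    by apply: sum_antisym => i j; rewrite cN mulrN addrC.
  rewrite -[LHS]addr0 -[X in _ + X]anti -big_split mulr_sumr /=.
  apply: eq_bigr => i _; rewrite -big_split !mulr_sumr /=.
  by apply: eq_bigr => j _; ring.
have c0 k : k != 0 -> \sum_(l < n.+1 | l != k) c k l = 0.
  move=> k0; have := stationary (fun i => (i == k)%:R).
  rewrite (eq_sym 0) (negPf k0) => /(_ erefl); rewrite half (bigD1 k)//= eqxx.
  rewrite [X in _ + X]big1 => [|i ik]; last by rewrite (negPf ik) mul0r.
  by rewrite mul1r addr0 => /eqP; rewrite mulf_eq0 pnatr_eq0 => /eqP.
have c00 : \sum_(l < n.+1 | l != 0) c 0 l = 0.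
  have := sum_antisym cN; rewrite (bigD1 0)//= [X in _ + X]big1 => [|k].
    by rewrite addr0.
  exact: c0.
move=> k; have /eqP : \sum_(l < n.+1 | l != k) c k l = 0.
  by have [->|/c0] := eqVneq k 0.
by rewrite bal !mulf_eq0 pnatr_eq0 (gt_eqF (m0 k)) => /eqP.
Qed.

End Critical.

(** * Equilibria on a horizontal circle *)

Section Circle.
Variables (R : realType) (r : R) (N : nat).
Hypothesis r0 : 0 < r.
Local Open Scope complex_scope.
Implicit Types (Gamma x : 'I_N -> R) (s : 'S_N) (z : config R N).

(** On a horizontal circle all the differences of positions are real, and the
    complex equations of motion reduce to the real balance equations for the
    vorticities read along the circle. *)
Lemma circle_equilibrium Gamma s z x y :
  (forall i, cyl_eq r (z (s i)) (Complex (x i) y)) ->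
  (forall k, velocity r Gamma z k = 0) <->
  cot_balanced (Gamma \o s) (fun i => x i / (2 * r)).
Proof.
move=> zx.
have cot_sumE k : cot_sum r Gamma z (s k) =
    (\sum_(l < N | l != k)
       Gamma (s l) * rcot (x k / (2 * r) - x l / (2 * r)))%:C.
  rewrite (rmorph_sum (real_complex R)) /cot_sum
    (reindex_inj (@perm_inj _ s)) /=.
  apply: eq_big => [l|l _]; first by rewrite (inj_eq perm_inj).
  have realM (a b : R) : (a * b)%:C = a%:C * b%:C by exact: rmorphM.
  rewrite [RHS]realM -ccot_real (ccot_cyl_eq r0 (cyl_eqB (zx k) (zx l))).
  congr (_ * ccot _).
  have -> : conjc (Complex (x k) y - Complex (x l) y) = (x k - x l)%:C.
    by apply/eqP; rewrite eq_complex /= subrr oppr0 !eqxx.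
  by rewrite -fmorphV -rmorphM mulrBl.
split=> [vz k|bal k].
  have /eqP := vz (s k); rewrite velocity_eq0// cot_sumE => /eqP.
  by move/complexI.
apply/eqP; rewrite velocity_eq0// -[k](permKV s) cot_sumE.
by rewrite [X in X%:C](bal (s^-1%g k)).
Qed.

Lemma ordered_cone_rescale x :
  (forall i j : 'I_N, (i < j)%N -> x i < x j < x i + 2 * pi * r) <->
  ordered_cone (fun i => x i / (2 * r)).
Proof.
have r2 : 0 < (2 * r)^-1 by rewrite invr_gt0 mulr_gt0.
have E i : x i / (2 * r) + pi = (x i + 2 * pi * r) / (2 * r).
  by field; rewrite gt_eqF.
by split=> cx i j /cx; rewrite /= E !ltr_pM2r.
Qed.

Lemma ordered_circle_in_phase_space s z x y :
  (forall i, cyl_eq r (z (s i)) (Complex (x i) y)) ->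
  ordered_cone (fun i => x i / (2 * r)) -> in_phase_space r z.
Proof.
move=> zx cx k l kl; rewrite -[k](permKV s) -[l](permKV s).
set i := s^-1%g k; set j := s^-1%g l => zkl.
have ij : j != i by rewrite (inj_eq perm_inj) eq_sym.
have [a /(congr1 (@complex.Re R)) /= xij] :=
  cyl_eq_trans (cyl_eq_sym (zx i)) (cyl_eq_trans zkl (zx j)).
have /eqP := ordered_cone_sin_neq0 cx ij; apply.
rewrite -mulrBl xij -[RHS](sin_pi_int R a); congr sin; field.
by rewrite gt_eqF.
Qed.

Lemma exists_unique_ordered_equilibrium Gamma s : (forall k, 0 < Gamma k) ->
  exists z : config R N,
    is_equilibrium r Gamma z /\ has_cyclic_order r s z /\
    forall z' : config R N,
      is_equilibrium r Gamma z' -> has_cyclic_order r s z' ->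
      translate_equiv r z z'.
Proof.
move=> G0; have m0 k : 0 < (Gamma \o s) k by exact: G0.
have [th [cth bth]] := cot_balanced_exists m0.
pose x i := 2 * r * th i.
have thE : (fun i => x i / (2 * r)) = th.
  by apply/funext => i; rewrite /x; field; rewrite gt_eqF.
pose z : config R N := fun k => (x (s^-1%g k))%:C.
have zx i : cyl_eq r (z (s i)) (Complex (x i) 0).
  by exists 0; rewrite /z permK subrr mulr0.
have cx : ordered_cone (fun i => x i / (2 * r)) by rewrite thE.
exists z; split; [split|split].
- exact: ordered_circle_in_phase_space zx cx.
- by apply/(circle_equilibrium _ zx); rewrite thE.
- by exists x, 0; split=> //; apply/ordered_cone_rescale.
move=> z' [_ vz'] [x' [y' [zx' /ordered_cone_rescale cx']]].
have bx' := (circle_equilibrium Gamma zx').1 vz'.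
have [d dE] := cot_balanced_unique m0 cth cx' bth bx'.
exists (Complex (2 * r * d) y') => k; rewrite /translate -[k](permKV s).
set i := s^-1%g k; apply: cyl_eq_trans (zx' i) _.
have -> : x' i = x i + 2 * r * d.
  have r2 : 2 * r != 0 by rewrite gt_eqF// mulr_gt0.
  by have /= di := dE i; rewrite -(divfK r2 (x' i)) di /x; ring.
have -> : Complex (x i + 2 * r * d) y' =
    Complex (x i) 0 + Complex (2 * r * d) y'.
  by apply/eqP; rewrite eq_complex /= add0r !eqxx.
apply: cyl_eqD; first exact: cyl_eq_sym.
by exists 0; rewrite subrr mulr0.
Qed.

Lemma is_equilibrium_oppr Gamma z :
  is_equilibrium r (fun k => - Gamma k) z <-> is_equilibrium r Gamma z.
Proof.
by split=> -[pz vz]; split=> // k; have := vz k; rewrite velocity_oppr;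
  [move=> /eqP; rewrite oppr_eq0 => /eqP | move=> ->; rewrite oppr0].
Qed.

End Circle.

(** * Equilibria and relative equilibria *)

Theorem theorem2 (R : realType) (r : R) (N : nat) (Gamma : 'I_N -> R) :
  0 < r ->
  (forall k : 'I_N, Gamma k != 0) ->
  \sum_(k < N) Gamma k != 0 ->
  (forall (J : set R) (w : R -> config R N),
     open J -> is_interval J -> J !=set0 ->
     is_relative_equilibrium r Gamma J w ->
     exists z0 : config R N,
       is_equilibrium r Gamma z0 /\
       forall t : R, J t -> same_config r (w t) z0) /\
  ((forall k : 'I_N, 0 < Gamma k) \/ (forall k : 'I_N, Gamma k < 0) ->
   (forall z : config R N, is_equilibrium r Gamma z -> aligned z) /\
   (forall s : 'S_N,
      exists z : config R N,
        is_equilibrium r Gamma z /\ has_cyclic_order r s z /\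
        forall z' : config R N,
          is_equilibrium r Gamma z' -> has_cyclic_order r s z' ->
          translate_equiv r z z')).
Proof.
move=> r0 _ sG; split.
  by move=> J w; exact: relative_equilibrium_is_equilibrium.
case=> [G0|Gneg].
  split=> [z|s]; first exact: equilibrium_aligned.
  exact: exists_unique_ordered_equilibrium.
have G0 k : 0 < - Gamma k by rewrite oppr_gt0.
split=> [z /is_equilibrium_oppr|s]; first exact: equilibrium_aligned.
have [z [ez [oz uz]]] := exists_unique_ordered_equilibrium r0 s G0.
exists z; split; first exact/is_equilibrium_oppr.
by split=> // z' /is_equilibrium_oppr; exact: uz.
Qed.
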